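(* Let $X$ be the blow-up of $\mathbb{P}^1\times\mathbb{P}^1$ over $\mathbb{Q}$ in $z_1=([0:1],[1:0])$ and $z_2=([1:0],[0:1])$, let $D\subset X$ be the strict transform of $\{s_0t_0=s_1t_1\}$, and let $\mathfrak{X}$, $\mathfrak{D}$, $\mathfrak{U}=\mathfrak{X}\setminus\mathfrak{D}$ be the integral models described in the context. Let $x=([1:1],[1:1])\in D(\mathbb{Q})$, and let $L_1$ and $L_2$ be the strict transforms in $X$ of the lines $s_0=s_1$ and $t_0=t_1$. Then $$\alpha(x,\mathfrak{U}\setminus(L_1\cup L_2);-K_X(D))=2.$$ Moreover, there exist a Zariski open subset $V\subseteq X$ and a (deformation) family $\{C_t\}_{t\in B}$, parametrized by some $B$, of log rational or toroidal curves sweeping out a Zariski dense subset of $X$ such that $$\alpha(x,\mathfrak{U}\cap C_t;-K_X(D))=\alpha(x,\mathfrak{U}\cap V;-K_X(D))\qquad\text{for all } t\in B.$$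
   Context: Geometry. $(s_0,s_1)$ and $(t_0,t_1)$ are the homogeneous coordinates on the two factors of $\mathbb{P}^1\times\mathbb{P}^1$. $X$ is a toric surface; $\mathfrak{X}$ is the toric $\mathbb{Z}$-scheme defined by the same fan. $\mathfrak{D}$ is the Zariski closure of $D$ in $\mathfrak{X}$, $\mathfrak{U}=\mathfrak{X}\setminus\mathfrak{D}$. A rational point $([s_0:s_1],[t_0:t_1])$ away from $z_1,z_2$, written with coprime integers in each pair, is integral on $\mathfrak{U}$ iff $s_0t_0-s_1t_1\in\{\pm\gcd(s_0,t_1)\gcd(s_1,t_0)\}$. The log anticanonical class $-K_X(D)=-K_X-D$ is the pullback of $\mathcal{O}(1,1)$. Height and distance. $H(y)=\max\{|s_0t_0|,|s_0t_1|,|s_1t_0|,|s_1t_1|\}$ for $y\in X(\mathbb{Q})$ with image $([s_0:s_1],[t_0:t_1])$ in coprime integer coordinates. $d=d_\infty$ is a real distance on $X(\mathbb{R})$ induced by a projective embedding; for $y=([s_0:s_1],[t_0:t_1])$ close to $x$ it satisfies $d(x,y)\asymp\max(|s_1/s_0-1|,|t_1/t_0-1|)$ (only its equivalence class up to bounded factors matters). Approximation constant. For $W\subseteq X(\mathbb{Q})$: $\alpha(x,W;-K_X(D))=\infty$ if $x$ is not in the closure of $W\setminus\{x\}$ in $X(\mathbb{R})$; otherwise it is the infimum of all $\alpha\in\mathbb{R}_{>0}$ for which there is a sequence $(y_n)_n\subseteq W\setminus\{x\}$ with $y_n\to x$ and $d(x,y_n)^\alpha H(y_n)$ bounded from above.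 For a subvariety or open subset $Z\subseteq X$, $\alpha(x,\mathfrak{U}\cap Z;\cdot)$ means $W=\mathfrak{U}(\mathbb{Z})\cap Z(\mathbb{Q})$, and $\alpha(x,\mathfrak{U}\setminus Z;\cdot)$ means $W=\mathfrak{U}(\mathbb{Z})\setminus Z(\mathbb{Q})$. Rational curves. A rational curve $C\subset X$ is the image of a nonconstant morphism $\mathbb{P}^1_{\mathbb{Q}}\to X$; its closure $\mathfrak{C}$ in $\mathfrak{X}$ carries the log structure $(\mathfrak{C},\mathfrak{D}\cap\mathfrak{C})$. With $\phi\colon\mathbb{P}^1_{\mathbb{Q}}\to C$ the normalization, the curve is log rational (resp. toroidal) if it is flat and projective, $\mathfrak{C}$ is birational to $\mathbb{P}^1_{\mathbb{Z}}$, and $\phi^{-1}(D)$, with reduced structure, has degree at most $1$ (resp. equal to $2$). *)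

(* Defs.v *)
From HB Require Import structures.
From mathcomp Require Import all_boot all_order all_algebra all_field.
From mathcomp Require Import mpoly.
From mathcomp Require Import zify ring.
From mathcomp Require Import boolp classical_sets reals constructive_ereal.
From mathcomp Require Import ereal topology normedtype sequences exp.

Set Implicit Arguments.
Unset Strict Implicit.
Unset Printing Implicit Defensive.

Import Order.TTheory GRing.Theory Num.Theory.
Import numFieldNormedType.Exports.

Local Open Scope classical_set_scope.
Local Open Scope ring_scope.

(* The points z1 and z2 form the closed subscheme s0 t0 = s1 t1 = 0 of         *)
(* P^1 x P^1, also over Z.  Hence the blow-up is the closure of the graph of   *)
(* [s0 t0 : s1 t1], i.e. the subscheme s0 t0 u1 = s1 t1 u0 of (P^1)^3, with    *)
(* coordinates ([s0 : s1], [t0 : t1], [u0 : u1]).  This equation defines the   *)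
(* toric Z-scheme.  A point of (P^1)^3 is given by a 3 x 2 matrix, whose rows  *)
(* are homogeneous coordinates on the three factors.                           *)

Section Coordinates.
Variable A : Type.
Implicit Type v : 'M[A]_(3, 2).
Definition s0 v := v 0 0.
Definition s1 v := v 0 1.
Definition t0 v := v 1 0.
Definition t1 v := v 1 1.
Definition u0 v := v 2%:R 0.
Definition u1 v := v 2%:R 1.
End Coordinates.

Definition on_X (A : comNzRingType) (v : 'M[A]_(3, 2)) : Prop :=
  s0 v * t0 v * u1 v = s1 v * t1 v * u0 v.

(* On the blow-up, (s0 t0, s1 t1) is the product of (u0, u1) with an equation  *)
(* of the exceptional curves; so the strict transform of s0 t0 = s1 t1 is      *)
(* u0 = u1, and the same equation defines its closure over Z.                  *)
Definition on_D (A : nzRingType) (v : 'M[A]_(3, 2)) : Prop := u0 v = u1 v.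

(* Equality of points of (P^1)^m in homogeneous coordinates. *)
Definition same_point (A : nzRingType) (m : nat) (v w : 'M[A]_(m, 2)) : Prop :=
  forall i, v i 0 * w i 1 = v i 1 * w i 0.

(* X(Q), in coprime integer coordinates.  These are unique up to a sign on     *)
(* each row; sets of points are understood up to [same_point].                 *)
Record XQ := PointXQ {
  coords :> 'M[int]_(3, 2);
  coords_coprime : forall i, coprimez (coords i 0) (coords i 1);
  coords_on_X : on_X coords
}.

Definition base_change (A : nzRingType) (y : XQ) : 'M[A]_(3, 2) :=
  map_mx intr y.

Fact pt11_coprime i :
  coprimez ((const_mx 1 : 'M[int]_(3, 2)) i 0) ((const_mx 1 : 'M[int]_(3, 2)) i 1).
Proof. by rewrite !mxE. Qed.

Fact pt11_on_X : on_X (const_mx 1 : 'M[int]_(3, 2)).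
Proof. by rewrite /on_X /s0 /s1 /t0 /t1 /u0 /u1 !mxE. Qed.

Definition pt11 : XQ := PointXQ pt11_coprime pt11_on_X.

(* U(Z): the section Spec Z -> X defined by y misses the closure of D, given   *)
(* by u0 - u1 = 0, iff the pullback of this equation is a unit of Z.           *)
Definition integral_points : set XQ :=
  [set y | u0 y - u1 y \is a GRing.unit].

(* The criterion in bihomogeneous coordinates, away from the exceptional       *)
(* curves, is [integral_pointsE] below.                                        *)
Lemma coprimez_cross (a b u v : int) : coprimez a b -> coprimez u v ->
  a * v = b * u -> exists2 e : int, e \is a GRing.unit & u = e * a /\ v = e * b.
Proof.
move=> ab uv E.
have au : (a %| u)%Z by rewrite -(Gauss_dvdzr _ ab) -E dvdz_mulr.
have ua : (u %| a)%Z by rewrite -(Gauss_dvdzl _ uv) E dvdz_mull.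
have bv : (b %| v)%Z by rewrite -(@Gauss_dvdzr b a) 1?coprimez_sym // E dvdz_mulr.
have vb : (v %| b)%Z by rewrite -(@Gauss_dvdzl v b u) 1?coprimez_sym // -E dvdz_mull.
case/dvdzP: au => e Ee; case/dvdzP: ua => f Ef.
case/dvdzP: bv => g Eg; case/dvdzP: vb => h Eh.
have [a0|a0] := eqVneq a 0.
  have b0 : b != 0 by apply: contraTneq ab => ->; rewrite a0.
  have hg : h * g = 1 by apply: (mulIf b0); rewrite mul1r -mulrA -Eg -Eh.
  exists g; last by rewrite Ee a0 !mulr0.
  by apply/unitrP; exists h; rewrite (mulrC g) hg; split.
have fe : f * e = 1 by apply: (mulIf a0); rewrite mul1r -mulrA -Ee -Ef.
exists e; first by apply/unitrP; exists f; rewrite (mulrC e) fe; split.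
split=> //; apply: (mulfI a0); rewrite E Ee; ring.
Qed.

Lemma gcdz_decomp (m n : int) : gcdz m n != 0 ->
  exists a b, [/\ m = a * gcdz m n, n = b * gcdz m n & coprimez a b].
Proof.
move=> g0; have /dvdzP[a Ea] := dvdz_gcdl m n; have /dvdzP[b Eb] := dvdz_gcdr m n.
exists a, b; split=> //.
have [u [v E]] := Bezoutz m n.
move: (gcdz m n) g0 Ea Eb E => g g0 -> -> E.
apply/coprimezP; exists (u, v); apply: (mulIf g0) => /=.
by rewrite mul1r -[RHS]E; ring.
Qed.

Lemma integral_pointsE (y : XQ) :
  ~~ ((s0 y == 0) && (t1 y == 0)) -> ~~ ((s1 y == 0) && (t0 y == 0)) ->
  integral_points y <->
  `|s0 y * t0 y - s1 y * t1 y| = gcdz (s0 y) (t1 y) * gcdz (s1 y) (t0 y).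
Proof.
move=> z1 z2; rewrite /integral_points /=.
have cs : coprimez (s0 y) (s1 y) := coords_coprime y 0.
have ct : coprimez (t0 y) (t1 y) := coords_coprime y 1.
have cu : coprimez (u0 y) (u1 y) := coords_coprime y 2%:R.
have := coords_on_X y; rewrite /on_X.
move: (s0 y) (s1 y) (t0 y) (t1 y) (u0 y) (u1 y) cs ct cu z1 z2 => {y} s s' t t' u u' cs ct cu.
rewrite -gcdz_eq0 -[X in _ -> ~~ X -> _]gcdz_eq0.
set g1 := gcdz s t'; set g2 := gcdz s' t => g1n g2n E.
have g1_ge0 : 0 <= g1 by []. have g2_ge0 : 0 <= g2 by [].
have [a [b [Ea Eb ab]]] := gcdz_decomp g1n.
have [c [d [Ec Ed cd]]] := gcdz_decomp g2n.
rewrite -/g1 in Ea Eb; rewrite -/g2 in Ec Ed.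
have abcd : coprimez (a * d) (c * b).
  move: cs ct; rewrite Ea Eb Ec Ed !coprimezMl !coprimezMr.
  move=> /andP[/andP[ac _] _] /andP[/andP[db _] _].
  by rewrite ac ab /= coprimez_sym cd db.
have E' : (a * d) * u' = (c * b) * u.
  apply: (mulfI (mulf_neq0 g1n g2n)).
  transitivity (s * t * u'); first by rewrite Ea Ed; ring.
  by rewrite E Ec Eb; ring.
have [e eU [-> ->]] := coprimez_cross abcd cu E'.
have -> : s * t - s' * t' = (g1 * g2) * (a * d - c * b) by rewrite Ea Eb Ec Ed; ring.
rewrite -mulrBr unitrM eU /= normrM ger0_norm ?mulr_ge0 //.
have gn : g1 * g2 != 0 by rewrite mulf_neq0.
move: (a * d - c * b) => w; split.
  by case/orP=> /eqP ->; rewrite ?normrN normr1 mulr1.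
move=> H; have : `|w| = 1 by apply: (mulfI gn); rewrite H mulr1.
by rewrite unfold_in /= => W; apply/orP; lia.
Qed.

(* The lines s0 = s1 and t0 = t1 avoid z1 and z2. *)
Definition L1 : set XQ := [set y | s0 y = s1 y].
Definition L2 : set XQ := [set y | t0 y = t1 y].

Definition height (y : XQ) : nat :=
  maxn (maxn `|s0 y * t0 y| `|s0 y * t1 y|)
       (maxn `|s1 y * t0 y| `|s1 y * t1 y|).

Section Approximation.
Variable R : realType.

Definition segre (v : 'M[R]_(3, 2)) (f : {ffun 'I_3 -> 'I_2}) : R :=
  \prod_i v i (f i).

(* The distance on X(R) induced by the Segre embedding into P^7: the sine of   *)
(* the angle between the lines spanned by two vectors of R^8.                  *)
Definition dist (v w : 'M[R]_(3, 2)) : R :=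
  Num.sqrt (1 - (\sum_f segre v f * segre w f) ^+ 2 /
                ((\sum_f segre v f ^+ 2) * (\sum_f segre w f ^+ 2))).

Definition distQ (x y : XQ) : R := dist (base_change R x) (base_change R y).

Definition in_closure (x : XQ) (W : set XQ) : Prop :=
  forall e : R, 0 < e ->
    exists y, [/\ W y, ~ same_point x y & distQ x y < e].

Definition admissible_exponent (x : XQ) (W : set XQ) (a : R) : Prop :=
  0 < a /\ exists y : nat -> XQ,
    [/\ forall n, W (y n) /\ ~ same_point x (y n),
        (fun n => distQ x (y n)) @ \oo --> (0 : R) &
        exists M : R, forall n, distQ x (y n) `^ a * (height (y n))%:R <= M].

Definition approx_const (x : XQ) (W : set XQ) : \bar R :=
  if `[< in_closure x W >]
  then ereal_inf [set a%:E | a in [set a | admissible_exponent x W a]]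
  else +oo%E.

End Approximation.

Definition evalX (p : {mpoly rat[3 * 2]}) (v : 'M[rat]_(3, 2)) : rat :=
  p.@[mxvec v 0].

(* Multihomogeneity of multidegree d; as Q is infinite, it can be tested on    *)
(* values.                                                                     *)
Definition multihomog (d : 'I_3 -> nat) (p : {mpoly rat[3 * 2]}) : Prop :=
  forall (c : 'rV[rat]_3) (v : 'M[rat]_(3, 2)),
    evalX p (diag_mx c *m v) = (\prod_i c 0 i ^+ d i) * evalX p v.

(* The set of rational points of a Zariski open subset of X. *)
Definition zariski_openX (V : set XQ) : Prop :=
  exists I : set {mpoly rat[3 * 2]},
    (forall p, I p -> exists d, multihomog d p) /\
    V = [set y | exists2 p, I p & evalX p (base_change rat y) != 0].

Definition zariski_denseX (W : set XQ) : Prop :=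
  forall d p, multihomog d p ->
    (forall y, W y -> evalX p (base_change rat y) = 0) ->
    forall y, evalX p (base_change rat y) = 0.

Section Curves.
Implicit Type phi : 'M[{mpoly rat[2]}]_(3, 2).

Definition evalP1 (F : fieldType) phi (z : 'rV[F]_2) : 'M[F]_(3, 2) :=
  map_mx (mmap ratr (z 0)) phi.

(* Three pairs of binary forms without common zeros define P^1_Q -> X. *)
Definition morphism_to_X phi : Prop :=
  [/\ exists e : 'I_3 -> nat, forall i j, phi i j \is (e i).-homog,
      forall z : 'rV[algC]_2, z != 0 -> forall i, row i (evalP1 phi z) != 0 &
      on_X phi].

(* phi is birational onto its image: it has the rational inverse [q : p]. *)
Definition birational_onto_image phi : Prop :=
  exists d p q,
    [/\ multihomog d p, multihomog d q,
        forall z : 'rV[rat]_2,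
          z 0 0 * evalX p (evalP1 phi z) = z 0 1 * evalX q (evalP1 phi z) &
        exists z : 'rV[rat]_2,
          evalX p (evalP1 phi z) != 0 \/ evalX q (evalP1 phi z) != 0].

(* Such a phi is nonconstant, and it is the normalization of its image C.  The *)
(* closure of C in the Z-scheme is an integral closed subscheme dominating     *)
(* Spec Z, with function field Q(P^1); so it is automatically projective and   *)
(* flat over Z, and birational to P^1_Z.                                       *)
Definition rational_curve phi : Prop :=
  morphism_to_X phi /\ birational_onto_image phi.

(* C(Q): the rational points among the images of the geometric points. *)
Definition curve_points phi : set XQ :=
  [set y | exists2 z : 'rV[algC]_2, z != 0 &
             same_point (evalP1 phi z) (base_change algC y)].

(* The reduced scheme phi^-1(D) is finite of degree k over Q, i.e. it has      *)
(* exactly k geometric points.                                                 *)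
Definition preimD_degree phi (k : nat) : Prop :=
  exists w : 'I_k -> 'rV[algC]_2,
    [/\ forall i, w i != 0,
        forall i j, same_point (w i) (w j) -> i = j &
        forall z : 'rV[algC]_2, z != 0 ->
          (on_D (evalP1 phi z) <-> exists i, same_point z (w i))].

Definition log_rational phi : Prop :=
  rational_curve phi /\ exists2 k, preimD_degree phi k & (k <= 1)%N.

Definition toroidal phi : Prop := rational_curve phi /\ preimD_degree phi 2.

End Curves.

Section Families.
Variable n : nat.
Implicit Type B : set ('I_n -> rat).

Definition zariski_closedA (Z : set ('I_n -> rat)) : Prop :=
  exists I : set {mpoly rat[n]}, Z = [set b | forall p, I p -> p.@[b] = 0].

(* The set of rational points of an irreducible locally closed subvariety of   *)
(* A^n in which the rational points are dense.                                 *)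
Definition parameter_variety B : Prop :=
  [/\ B !=set0,
      exists Z1 Z2, [/\ zariski_closedA Z1, zariski_closedA Z2 &
                        B = Z1 `\` Z2] &
      forall p q : {mpoly rat[n]}, (forall b, B b -> p.@[b] * q.@[b] = 0) ->
        (forall b, B b -> p.@[b] = 0) \/ (forall b, B b -> q.@[b] = 0)].

Definition member (Phi : 'M[{mpoly {mpoly rat[n]}[2]}]_(3, 2))
    (b : 'I_n -> rat) : 'M[{mpoly rat[2]}]_(3, 2) :=
  map_mx (map_mpoly (meval b)) Phi.

(* A morphism B x P^1 -> X, given by binary forms of fixed degrees whose       *)
(* coefficients are polynomials in the parameters, such that every restriction *)
(* {b} x P^1 -> X is birational onto its image.                                *)
Definition family_of_rational_curves B
    (Phi : 'M[{mpoly {mpoly rat[n]}[2]}]_(3, 2)) : Prop :=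
  [/\ parameter_variety B,
      exists e : 'I_3 -> nat, forall i j, Phi i j \is (e i).-homog &
      forall b, B b -> rational_curve (member Phi b)].

Definition swept_out B (Phi : 'M[{mpoly {mpoly rat[n]}[2]}]_(3, 2)) : set XQ :=
  [set y | exists2 b, B b & curve_points (member Phi b) y].

End Families.

(* Main.v *)
Require Import Defs.
From HB Require Import structures.
From mathcomp Require Import all_boot all_order all_algebra all_field.
From mathcomp Require Import mpoly.
From mathcomp Require Import zify ring lra.
From mathcomp Require Import boolp classical_sets reals constructive_ereal.
From mathcomp Require Import ereal topology normedtype sequences exp.

(** Take a rational point off [L1] and [L2], in coprime integral coordinates.  The
angle between [(s0, s1)] and [(1, 1)] has squared sine
[(s0 - s1)^2 / (2 (s0^2 + s1^2))], and similarly for [t]; both are at most [dist^2].  As [s0 - s1] and [t0 - t1] are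
nonzero integers and [height^2] is comparable to
[(s0^2 + s1^2) (t0^2 + t1^2)], the product of the two sines gives
[1/4 <= dist^2 * height] ([distQ_height_ge]).  Hence no exponent below [2] is
admissible for a set of points off the two lines ([admissible_exponent_ge2]).

The upper bound and the family come from the curves of bidegree [(1, 1)] in
P^1 x P^1 through [z1] and [x].  They form a one-parameter family, [curve b]
below, and their strict transforms have class [(1, 1) - E1].  Since [D] has class
[(1, 1) - E1 - E2], the intersection number with [D] is [2 - 1 = 1]: the curve
meets [D] in [x] alone, so it is log rational.  The restriction of the height to
such a curve is quadratic in the parameter, while the distance to [x] is the
inverse of a linear form; thus [dist^2 * height] is bounded along every sequence
of points with [(m : 1)] as parameter.  For [b = p / q] in lowest terms and
[N = q - p], the parameters [m = N K - 1] with [q] dividing [K] give integral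
points: then [u = (p K + 1, p K)] ([curve_point]).  So every curve of the family
has constant [2] ([approx_const_through_curve]), and so does any set of integral
points off the lines that contains one of these sequences, in particular that of
all integral points in the open set [V], the complement of [L1] and [L2].

For the density of the family, the form [generic_form] vanishes at every
point that the family does not sweep out.  If a form [p] vanishes at all points
that it does sweep out, then the product of [p] and [generic_form] vanishes on all
of [X], and restricting to a polynomial path on [X] from an
arbitrary point to a point where [generic_form] is nonzero shows that [p] vanishes at
the former ([evalX_eq0_on_X]). *)

Set Implicit Arguments.
Unset Strict Implicit.
Unset Printing Implicit Defensive.
Import Order.TTheory GRing.Theory Num.Theory.
Import numFieldNormedType.Exports.
Local Open Scope classical_set_scope.
Local Open Scope ring_scope.

(** * Distance to the point x and the lower bound *)

Section Distance.
Variable R : realType.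
Implicit Types (v w : 'M[R]_(3, 2)) (y : XQ) (W : set XQ).

(** The Segre embedding turns scalar products of the three factors into their
product; this is what splits the distance into angles on each factor. *)
Lemma sum_segreM v w :
  \sum_f segre v f * segre w f = \prod_i (v i 0 * w i 0 + v i 1 * w i 1).
Proof.
transitivity (\prod_i \sum_(j < 2) v i j * w i j); last first.
  apply: eq_bigr => i _; rewrite big_ord_recl big_ord1.
  by congr (_ + v _ _ * w _ _); apply/val_inj.
by rewrite bigA_distr_bigA; apply: eq_bigr => f _; rewrite -big_split.
Qed.

(** The squared sine of the angle between [(a, b)] and [(1, 1)]. *)
Definition sin2 (a b : R) : R := (a - b) ^+ 2 / (2 * (a ^+ 2 + b ^+ 2)).

Definition row_sin2 y i : R := sin2 (y i 0)%:~R (y i 1)%:~R.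

Lemma sqr_sum_coprime_gt0 (a b : int) :
  coprimez a b -> 0 < (a%:~R : R) ^+ 2 + b%:~R ^+ 2.
Proof.
move=> ab; rewrite lt_def addr_ge0 ?sqr_ge0 // andbT paddr_eq0 ?sqr_ge0 //.
rewrite !sqrf_eq0 !intr_eq0; apply/negP => /andP[/eqP a0 /eqP b0].
by move: ab; rewrite a0 b0.
Qed.

Lemma sin2_ge0 a b : 0 <= sin2 a b.
Proof. by rewrite divr_ge0 ?sqr_ge0 ?mulr_ge0 ?ler0n ?addr_ge0 ?sqr_ge0. Qed.

Lemma sin2_le1 a b : sin2 a b <= 1.
Proof.
have [ab0|ab0] := eqVneq (a ^+ 2 + b ^+ 2) 0.
  by rewrite /sin2 ab0 mulr0 invr0 mulr0.
have ab_gt0 : 0 < a ^+ 2 + b ^+ 2 by rewrite lt_def ab0 addr_ge0 ?sqr_ge0.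
rewrite ler_pdivrMr ?mulr_gt0 // mul1r.
by have := sqr_ge0 (a + b); nra.
Qed.

Lemma one_minus_sin2 (a b : R) : 0 < a ^+ 2 + b ^+ 2 ->
  (a + b) ^+ 2 / (2 * (a ^+ 2 + b ^+ 2)) = 1 - sin2 a b.
Proof. by move=> /lt0r_neq0 h; rewrite /sin2; field. Qed.

(** The cosine of the angle between two Segre vectors is the product of the
cosines of the angles between their factors. *)
Lemma distQ_pt11 y : distQ R pt11 y = Num.sqrt (1 - \prod_i (1 - row_sin2 y i)).
Proof.
rewrite /distQ /dist; congr (Num.sqrt (1 - _)).
have -> v : \sum_f segre v f ^+ 2 = \sum_f segre v f * segre v f.
  by apply: eq_bigr => f _; rewrite expr2.
have -> v : \sum_f segre v f ^+ 2 = \sum_f segre v f * segre v f.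
  by apply: eq_bigr => f _; rewrite expr2.
rewrite !sum_segreM -prodrXl -big_split -prodf_div; apply: eq_bigr => i _.
rewrite !mxE /= -one_minus_sin2 ?sqr_sum_coprime_gt0 ?coords_coprime //.
by rewrite !mul1r.
Qed.

Lemma distQ_pt11_ge0 y : 0 <= distQ R pt11 y.
Proof. exact: sqrtr_ge0. Qed.

Lemma prod_cos2_bounds y : 0 <= \prod_i (1 - row_sin2 y i) <= 1.
Proof.
apply/andP; split.
  by apply: prodr_ge0 => i _; rewrite subr_ge0 sin2_le1.
by apply: prodr_ile1 => i _; rewrite subr_ge0 sin2_le1 gerBl sin2_ge0.
Qed.

Lemma distQ_pt11_sqr y :
  distQ R pt11 y ^+ 2 = 1 - \prod_i (1 - row_sin2 y i).
Proof.
by rewrite distQ_pt11 sqr_sqrtr // subr_ge0; case/andP: (prod_cos2_bounds y).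
Qed.

Lemma row_sin2_le_distQ y i : row_sin2 y i <= distQ R pt11 y ^+ 2.
Proof.
rewrite distQ_pt11_sqr (bigD1 i) //= lerBrDl -lerBrDr.
rewrite ler_piMr ?subr_ge0 ?sin2_le1 //.
by apply: prodr_ile1 => j _; rewrite subr_ge0 sin2_le1 gerBl sin2_ge0.
Qed.

Lemma distQ_le_sum_sin2 y : distQ R pt11 y ^+ 2 <= \sum_i row_sin2 y i.
Proof.
rewrite distQ_pt11_sqr !big_ord_recl !big_ord0 /=.
set a := row_sin2 y _; set b := row_sin2 y _; set c := row_sin2 y _.
have a0 : 0 <= a := sin2_ge0 _ _; have b0 : 0 <= b := sin2_ge0 _ _.
have c0 : 0 <= c := sin2_ge0 _ _; have c1 : 0 <= 1 - c by rewrite subr_ge0 sin2_le1.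
have := mulr_ge0 (mulr_ge0 a0 b0) c1; have := mulr_ge0 a0 c0.
by have := mulr_ge0 b0 c0; nra.
Qed.

(** The maximum of two squares is at least half of their sum, in each factor. *)
Lemma height_sqr_ge y :
  ((s0 y)%:~R ^+ 2 + (s1 y)%:~R ^+ 2) * ((t0 y)%:~R ^+ 2 + (t1 y)%:~R ^+ 2)
    <= 4 * ((height y)%:R : R) ^+ 2.
Proof.
have le_height (a b : int) : (absz (a * b)%R <= height y)%N ->
    (a%:~R : R) ^+ 2 * b%:~R ^+ 2 <= (height y)%:R ^+ 2.
  move=> ab; rewrite -exprMn -intrM -[leLHS]ger0_norm ?sqr_ge0 // normrX.
  rewrite lerXn2r ?nnegrE ?normr_ge0 //.
  by rewrite -intr_norm -abszE pmulrn ler_int lez_nat.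
have h00 : (absz (s0 y * t0 y)%R <= height y)%N by rewrite /height; lia.
have h01 : (absz (s0 y * t1 y)%R <= height y)%N by rewrite /height; lia.
have h10 : (absz (s1 y * t0 y)%R <= height y)%N by rewrite /height; lia.
have h11 : (absz (s1 y * t1 y)%R <= height y)%N by rewrite /height; lia.
rewrite mulrDl !mulrDr.
move: (le_height _ _ h00) (le_height _ _ h01).
by move: (le_height _ _ h10) (le_height _ _ h11); lra.
Qed.

(** Off [L1] and [L2] the numerators [s0 - s1] and [t0 - t1] of the two sines
are nonzero integers, while the product of the denominators is of order
[height ^ 2]. *)
Lemma distQ_height_ge y : ~ L1 y -> ~ L2 y ->
  1 / 4 <= distQ R pt11 y ^+ 2 * (height y)%:R.
Proof.
move=> nL1 nL2.
have int_sqr_ge1 (a b : int) : a <> b -> 1 <= ((a%:~R - b%:~R : R)) ^+ 2.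
  by move=> ab; rewrite -intrB -rmorphXn /= ler1z expr2; nia.
set d := distQ _ _ _; set h : R := _%:R.
have hs := row_sin2_le_distQ y 0; have ht := row_sin2_le_distQ y 1.
have ps := @sqr_sum_coprime_gt0 _ _ (coords_coprime y 0).
have pt := @sqr_sum_coprime_gt0 _ _ (coords_coprime y 1).
have := height_sqr_ge y.
rewrite -/d /row_sin2 /sin2 !ler_pdivrMr ?mulr_gt0 // in hs ht.
move: hs ht ps pt (int_sqr_ge1 _ _ nL1) (int_sqr_ge1 _ _ nL2).
rewrite -/(s0 y) -/(s1 y) -/(t0 y) -/(t1 y) -/h.
set S := _ ^+ 2 + _ ^+ 2; set T := (t0 y)%:~R ^+ 2 + _ ^+ 2.
move=> hs ht S0 T0 s_ge1 t_ge1 hST.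
have h0 : 0 <= h by rewrite /h ler0n.
have dS : 1 <= d ^+ 2 * (2 * S) := le_trans s_ge1 hs.
have dT : 1 <= d ^+ 2 * (2 * T) := le_trans t_ge1 ht.
have dST := ler_pM ler01 ler01 dS dT.
have d4 : 0 <= d ^+ 2 ^+ 2 by rewrite sqr_ge0.
have dh0 : 0 <= d ^+ 2 * h by rewrite mulr_ge0 ?sqr_ge0.
have le4 : d ^+ 2 ^+ 2 * (S * T) <= d ^+ 2 ^+ 2 * (4 * h ^+ 2) by rewrite ler_wpM2l.
have : (1 / 4) ^+ 2 <= (d ^+ 2 * h) ^+ 2 by nra.
by rewrite ler_sqr // nnegrE.
Qed.


(** Write [dist^2 * height] as [dist^(2 - a) * (dist^a * height)].  For [a < 2] the
first factor tends to [0] along a sequence converging to [x] and the second one is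
bounded, against [distQ_height_ge]. *)
Lemma admissible_exponent_ge2 W (a : R) :
    (forall y, W y -> ~ same_point pt11 y -> ~ L1 y /\ ~ L2 y) ->
  admissible_exponent pt11 W a -> 2 <= a.
Proof.
move=> W_off [a_gt0 [y [yW y_cvg [M yM]]]]; rewrite leNgt; apply/negP => a_lt2.
have b_gt0 : 0 < 2 - a by rewrite subr_gt0.
have d2h n : 1 / 4 <= distQ R pt11 (y n) ^+ 2 * (height (y n))%:R.
  by have [Wn nx] := yW n; apply: distQ_height_ge; case: (W_off _ Wn nx).
have M0 : 0 <= M by apply: le_trans (yM 0%N); rewrite mulr_ge0 ?powR_ge0.
(* [c] is chosen so that [c * M < 1 / 4], contradicting [d2h]. *)
pose c := 1 / 4 / (M + 1).
have c0 : 0 < c by rewrite /c !divr_gt0 //; lra.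
have e0 : 0 < c `^ (2 - a)^-1 by apply: powR_gt0.
have /cvgrPdist_lt/(_ _ e0)[n _ /(_ n (leqnn n))] := y_cvg.
rewrite /= sub0r normrN ger0_norm ?distQ_pt11_ge0 // => dn.
set d := distQ R pt11 (y n) in dn *.
have d0 : 0 <= d := distQ_pt11_ge0 _.
have db : d `^ (2 - a) < c.
  have -> : c = (c `^ (2 - a)^-1) `^ (2 - a).
    by rewrite -powRrM mulVf ?gt_eqF // powRr1 // ltW.
  by apply: gt0_ltr_powR; rewrite ?nnegrE // ltW.
have := d2h n; rewrite -/d -(powR_mulrn 2 d0) -[2%:R](subrK a).
rewrite powRD; last by rewrite subrK pnatr_eq0.
have := yM n; rewrite -/d -mulrA; move: (d `^ a * _) (powR_ge0 d (2 - a)) db.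
move=> z z0 zc zM.
have cM : c * (M + 1) = 1 / 4 by rewrite /c; field; lra.
by move: (d `^ _) z0 zc => w w0 wc; nra.
Qed.

(** A sequence with distance of order [1 / n] and height of order [n^2] realizes the
exponent [2], which is then the least one. *)
Lemma approx_const_eq2 W (y : nat -> XQ) (C : R) :
    (forall y, W y -> ~ same_point pt11 y -> ~ L1 y /\ ~ L2 y) ->
    (forall n, W (y n) /\ ~ same_point pt11 (y n)) ->
    (forall n, distQ R pt11 (y n) <= C / n.+1%:R) ->
    (forall n, (height (y n))%:R <= C * n.+1%:R ^+ 2) ->
  approx_const R pt11 W = 2%:E.
Proof.
move=> W_off yW yd yh.
have y_cvg : (fun n => distQ R pt11 (y n)) @ \oo --> (0 : R).
  have C_cvg : (fun n => C / n.+1%:R) @ \oo --> (0 : R).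
    by rewrite -(mulr0 C); apply: cvgM; [exact: cvg_cst | exact: cvg_harmonic].
  apply: squeeze_cvgr (cvg_cst 0) C_cvg; near=> n.
  by rewrite distQ_pt11_ge0 yd.
rewrite /approx_const asboolT; last first.
  move=> e e0; have /cvgrPdist_lt/(_ _ e0)[n _ /(_ n (leqnn n))] := y_cvg.
  rewrite /= sub0r normrN ger0_norm ?distQ_pt11_ge0 // => dn.
  by have [Wn nx] := yW n; exists (y n).
apply/eqP; rewrite eq_le; apply/andP; split; last first.
  apply: le_ereal_inf_tmp => _ [a /(admissible_exponent_ge2 W_off) a2 <-].
  by rewrite lee_fin.
apply: ge_ereal_inf; exists 2%:E => //; exists 2 => //; split => //.
exists y; split => //; exists (C ^+ 3) => n.
rewrite powR_mulrn ?distQ_pt11_ge0 //.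
have n0 : 0 < n.+1%:R :> R by rewrite ltr0n.
apply: le_trans (_ : (C / n.+1%:R) ^+ 2 * (C * n.+1%:R ^+ 2) <= _); last first.
  by rewrite le_eqVlt; apply/orP; left; apply/eqP; field; rewrite gt_eqF.
apply: ler_pM; rewrite ?sqr_ge0 ?ler0n ?yh //.
by rewrite lerXn2r ?nnegrE ?distQ_pt11_ge0 // (le_trans (distQ_pt11_ge0 _) (yd n)).
Unshelve. all: by end_near. Qed.

End Distance.

(** * The pencil of curves *)

Definition mx32 (A : Type) (a b c d e f : A) : 'M[A]_(3, 2) :=
  \matrix_(i, j) nth a (nth [::] [:: [:: a; b]; [:: c; d]; [:: e; f]] i) j.

Lemma mx32E (A : Type) (a b c d e f : A) (v := mx32 a b c d e f) :
  (v 0 0 = a) * (v 0 1 = b) * (v 1 0 = c) * (v 1 1 = d) *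
  (v 2%:R 0 = e) * (v 2%:R 1 = f).
Proof. by rewrite !mxE. Qed.

Lemma forall_ord3 (P : 'I_3 -> Prop) : P 0 -> P 1 -> P 2%:R -> forall i, P i.
Proof.
by move=> P0 P1 P2 [[|[|[|//]]] hi];
  [move: P0 | move: P1 | move: P2]; congr (P _); apply/val_inj.
Qed.

Lemma forall_ord2 (P : 'I_2 -> Prop) : P 0 -> P 1 -> forall i, P i.
Proof.
by move=> P0 P1 [[|[|//]] hi]; [move: P0 | move: P1]; congr (P _); apply/val_inj.
Qed.

Lemma map_mx32 (A B : Type) (g : A -> B) (a b c d e f : A) :
  map_mx g (mx32 a b c d e f) = mx32 (g a) (g b) (g c) (g d) (g e) (g f).
Proof. by apply/matrixP; elim/forall_ord3; elim/forall_ord2; rewrite mxE !mx32E. Qed.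

(** In the coordinates [(m, w)] on P^1, the value [m = 0] is sent to [z1] and
[w = 0] to [x].  The third row is [(s0 t0, s1 t1)] divided by its common factor
[m].  Keeping the ring of coefficients arbitrary makes one definition serve both
for a single curve and for the whole family, where [b] is the variable. *)
Definition curve (A : comNzRingType) (b : A) : 'M[{mpoly A[2]}]_(3, 2) :=
  mx32 'X_0 ('X_0 + 'X_1)
       (b *: 'X_0 + 'X_1) (b *: 'X_0)
       (b *: 'X_0 + 'X_1) (b *: ('X_0 + 'X_1)).

Definition curve_family : 'M[{mpoly {mpoly rat[1]}[2]}]_(3, 2) := curve 'X_0.

(** At [b = 0] the second factor is constant, and at [b = 1] the curve is [D]. *)
Definition parameters : set ('I_1 -> rat) := [set b | b 0 != 0 /\ b 0 != 1].

Lemma member_family b : member curve_family b = curve (b 0).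
Proof.
have gX k : map_mpoly (meval b) 'X_k = 'X_k :> {mpoly rat[2]}.
  exact: map_mpolyX.
have gD (p q : {mpoly {mpoly rat[1]}[2]}) : map_mpoly (meval b) (p + q) =
    map_mpoly (meval b) p + map_mpoly (meval b) q by exact: raddfD.
have gZ c (p : {mpoly {mpoly rat[1]}[2]}) : map_mpoly (meval b) (c *: p) =
    c.@[b] *: map_mpoly (meval b) p by exact: map_mpolyZ.
rewrite /member map_mx32; move: (map_mpoly _) gX gD gZ => g gX gD gZ.
by rewrite !(gX, gD, gZ) mevalXU.
Qed.

Lemma evalP1_curve (F : numFieldType) (b : rat) (z : 'rV[F]_2) (m := z 0 0)
    (w := z 0 1) (c : F := ratr b) :
  evalP1 (curve b) z =
    mx32 m (m + w) (c * m + w) (c * m) (c * m + w) (c * (m + w)).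
Proof.
have gX k : mmap ratr (z 0) 'X_k = z 0 k by rewrite mmapX mmap1U.
have gD (p q : {mpoly rat[2]}) : mmap ratr (z 0) (p + q) =
    mmap ratr (z 0) p + mmap ratr (z 0) q by exact: mmapD.
have gZ a (p : {mpoly rat[2]}) : mmap ratr (z 0) (a *: p) =
    ratr a * mmap ratr (z 0) p by exact: mmapZ.
rewrite /evalP1 map_mx32; move: (mmap _ _) gX gD gZ => g gX gD gZ.
by rewrite !(gX, gD, gZ).
Qed.

Lemma curve_homog (A : comNzRingType) (b : A) i j : curve b i j \is 1.-homog.
Proof.
have hX k : ('X_k : {mpoly A[2]}) \is 1.-homog by rewrite dhomogX /= mdeg1.
move: i j; elim/forall_ord3; elim/forall_ord2; rewrite mx32E;
  by rewrite ?(rpredD, rpredZ, hX).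
Qed.

Lemma curve_on_X (A : comNzRingType) (b : A) : on_X (curve b).
Proof.
rewrite /on_X /s0 /s1 /t0 /t1 /u0 /u1 !mx32E -!mul_mpolyC; ring.
Qed.

Lemma rV2_neq0 (F : fieldType) (z : 'rV[F]_2) :
  z != 0 <-> ~ (z 0 0 = 0 /\ z 0 1 = 0).
Proof.
split=> [z0 [z00 z01]|z0].
  move/eqP: z0; apply; apply/rowP; elim/forall_ord2; by rewrite mxE.
by apply/eqP => E; apply: z0; rewrite E !mxE.
Qed.

Lemma curve_morphism (b : rat) : b != 0 -> b != 1 -> morphism_to_X (curve b).
Proof.
move=> b0 b1; split; last exact: curve_on_X.
  by exists (fun=> 1%N) => i j; exact: curve_homog.
move=> z /rV2_neq0 z0; rewrite evalP1_curve.
set c : algC := ratr b.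
have c0 : c != 0 by rewrite fmorph_eq0.
have c1 : 1 - c != 0 by rewrite subr_eq0 eq_sym fmorph_eq1.
elim/forall_ord3; apply/rV2_neq0; rewrite !mxE /= => -[E1 E2]; apply: z0.
- by move: E2; rewrite E1 add0r.
- have z00 : z 0 0 = 0 by apply: (mulfI c0); rewrite mulr0.
  by move: E1; rewrite z00 mulr0 add0r.
- have z01 : z 0 1 = 0.
    apply: (mulfI c1); rewrite mulr0.
    have -> : (1 - c) * z 0 1 = (c * z 0 0 + z 0 1) - c * (z 0 0 + z 0 1) by ring.
    by rewrite E1 E2 subrr.
  split=> //; apply: (mulfI c0).
  by move: E1; rewrite z01 addr0 mulr0.
Qed.

Definition coordX (i : 'I_3) (j : 'I_2) : {mpoly rat[3 * 2]} :=
  'X_(mxvec_index i j).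

Lemma evalX_coord i j v : evalX (coordX i j) v = v i j.
Proof. by rewrite /evalX mevalXU mxvecE. Qed.

Lemma evalXB p q v : evalX (p - q) v = evalX p v - evalX q v.
Proof. exact: mevalB. Qed.

Lemma evalXM p q v : evalX (p * q) v = evalX p v * evalX q v.
Proof. exact: mevalM. Qed.

Lemma multihomog_coord i j :
  multihomog (fun k => (k == i) : nat) (coordX i j).
Proof.
move=> c v; rewrite !evalX_coord mul_diag_mx mxE (bigD1 i) //= eqxx expr1.
by rewrite big1 ?mulr1 // => k /negPf ->; rewrite expr0.
Qed.

Lemma multihomogB d p q :
  multihomog d p -> multihomog d q -> multihomog d (p - q).
Proof. by move=> hp hq c v; rewrite !evalXB hp hq mulrBr. Qed.

Lemma multihomogM d e p q : multihomog d p -> multihomog e q ->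
  multihomog (fun i => (d i + e i)%N) (p * q).
Proof.
move=> hp hq c v; rewrite !evalXM hp hq mulrACA -big_split /=.
by congr (_ * _); apply: eq_bigr => i _; rewrite exprD.
Qed.

(** The first factor is an isomorphism on the curve: [m = s0] and [w = s1 - s0]. *)
Lemma curve_birational (b : rat) : birational_onto_image (curve b).
Proof.
exists (fun k => (k == 0) : nat), (coordX 0 1 - coordX 0 0), (coordX 0 0).
split; try by do ?apply: multihomogB; apply: multihomog_coord.
  move=> z; rewrite evalXB !evalX_coord evalP1_curve !mx32E; ring.
exists (const_mx 1); right.
by rewrite evalX_coord evalP1_curve !mx32E mxE.
Qed.

Lemma curve_rational (b : rat) : b != 0 -> b != 1 -> rational_curve (curve b).
Proof. by move=> b0 b1; split; [exact: curve_morphism | exact: curve_birational]. Qed.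

(** On the curve [u0 - u1 = (1 - b) w], so that [D] is met only at [w = 0]. *)
Lemma curve_preimD (b : rat) : b != 1 -> preimD_degree (curve b) 1.
Proof.
move=> b1; exists (fun=> delta_mx 0 0); split.
- by move=> _; apply/rV2_neq0; rewrite !mxE /= => -[/eqP]; rewrite oner_eq0.
- by move=> i j _; rewrite !ord1.
move=> z z0; rewrite evalP1_curve /on_D /u0 /u1 !mx32E.
set c : algC := ratr b.
have c1 : 1 - c != 0 by rewrite subr_eq0 eq_sym fmorph_eq1.
split=> [E|[_ /(_ 0)]].
  exists 0 => i; rewrite ord1 !mxE /= mulr0 mulr1; apply/esym.
  apply: (mulfI c1); rewrite mulr0.
  have -> : (1 - c) * z 0 1 = (c * z 0 0 + z 0 1) - c * (z 0 0 + z 0 1) by ring.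
  by rewrite E subrr.
by rewrite !mxE /= mulr0 mulr1 => <-; rewrite !addr0.
Qed.

Lemma curve_log_rational (b : rat) : b != 0 -> b != 1 -> log_rational (curve b).
Proof.
move=> b0 b1; split; first exact: curve_rational.
by exists 1%N => //; exact: curve_preimD.
Qed.

Lemma coprime_diag_neq0 (a b : int) : coprimez a b -> a = b -> a != 0.
Proof. by move=> + E; rewrite E; apply: contraTneq => ->. Qed.

(** Both [s1 - s0] and [t0 - t1] restrict to [w], which vanishes only over [x]. *)
Lemma curve_points_off_lines (b : rat) y : b != 0 ->
  curve_points (curve b) y -> ~ same_point pt11 y -> ~ L1 y /\ ~ L2 y.
Proof.
move=> b0 [z z0 yz] yx.
have c0 : ratr b != 0 :> algC by rewrite fmorph_eq0.
have cop i := coords_coprime y i.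
have w0 : z 0 1 <> 0.
  move=> w0; apply: yx.
  have z00 : z 0 0 != 0.
    by apply/eqP => z00; move/rV2_neq0: z0; apply.
  move: yz; rewrite evalP1_curve w0 !addr0 => yz.
  elim/forall_ord3; rewrite !mxE /= !mul1r.
  - have := yz 0; rewrite !mx32E !mxE => /(mulfI z00)/eqP.
    by rewrite eqr_int => /eqP.
  - have := yz 1; rewrite !mx32E !mxE => /(mulfI (mulf_neq0 c0 z00))/eqP.
    by rewrite eqr_int => /eqP.
  - have := yz 2%:R; rewrite !mx32E !mxE => /(mulfI (mulf_neq0 c0 z00))/eqP.
    by rewrite eqr_int => /eqP.
split=> E; apply: w0.
  have n0 : (s0 y)%:~R != 0 :> algC.
    by rewrite intr_eq0; exact: coprime_diag_neq0 (cop 0) E.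
  have := yz 0; rewrite evalP1_curve !mx32E !mxE -[y 0 1]/(s1 y) -E.
  rewrite mulrDl -[LHS]addr0 => /addrI/esym/eqP.
  by rewrite mulf_eq0 (negPf n0) orbF => /eqP.
have n0 : (t0 y)%:~R != 0 :> algC.
  by rewrite intr_eq0; exact: coprime_diag_neq0 (cop 1) E.
have := yz 1; rewrite evalP1_curve !mx32E !mxE -[y 1 1]/(t1 y) -E.
rewrite mulrDl -[RHS]addr0 => /addrI/eqP.
by rewrite mulf_eq0 (negPf n0) orbF => /eqP.
Qed.

Lemma numDomain_poly_eq0 (F : numDomainType) (p : {poly F}) :
  (forall x, p.[x] = 0) -> p = 0.
Proof.
move=> p0; apply/eqP/negPn/negP => pn0.
have := @max_poly_roots _ p [seq i%:R | i <- iota 0 (size p)] pn0.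
rewrite size_map size_iota ltnn => H; apply: notF; apply: H.
  by apply/allP => x _; apply/rootP.
by rewrite map_inj_uniq ?iota_uniq // => i j /eqP; rewrite eqr_nat => /eqP.
Qed.

Lemma meval_poly n (p : {mpoly rat[n]}) (h : 'I_n -> {poly rat}) :
  exists P : {poly rat}, forall x, p.@[fun i => (h i).[x]] = P.[x].
Proof.
exists (mmap polyC h p) => x; rewrite mevalE horner_sum; apply: eq_bigr => m _.
rewrite hornerM hornerC /mmap1 horner_prod; congr (_ * _).
by apply: eq_bigr => i _; rewrite horner_exp.
Qed.

(** The parameters are the affine line minus two points; irreducibility reduces to
[{poly rat}] being a domain, applied to [P * Q * ('X * ('X - 1))]. *)
Lemma parameters_variety : parameter_variety parameters.
Proof.
split.
- by exists (fun=> 2).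
- exists setT, [set b | b 0 * (b 0 - 1) = 0]; split.
  + exists set0; apply/seteqP; split=> // b _ p [].
  + exists [set 'X_0 * ('X_0 - 1)]; apply/seteqP; split=> b.
      by move=> b0 _ ->; rewrite mevalM mevalB mevalXU meval1.
    by move=> /(_ _ erefl); rewrite mevalM mevalB mevalXU meval1.
  + apply/seteqP; split=> b /=.
      move=> [b0 b1]; split=> //; apply/eqP.
      by rewrite mulf_neq0 // subr_eq0.
    move=> [_ /eqP]; rewrite mulf_eq0 subr_eq0 negb_or => /andP[]; by split.
move=> p q pq.
have [P hP] := meval_poly p (fun=> 'X); have [Q hQ] := meval_poly q (fun=> 'X).
have evP b : p.@[b] = P.[b 0].
  by rewrite -hP; apply: meval_eq => i; rewrite hornerX !ord1.
have evQ b : q.@[b] = Q.[b 0].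
  by rewrite -hQ; apply: meval_eq => i; rewrite hornerX !ord1.
have /eqP : P * Q * ('X * ('X - 1%:P)) = 0.
  apply: numDomain_poly_eq0 => x; rewrite 3!hornerM hornerX hornerXsubC.
  have [->|x0] := eqVneq x 0; first by rewrite mul0r mulr0.
  have [->|x1] := eqVneq x 1; first by rewrite subrr !mulr0.
  have := pq (fun=> x) (conj x0 x1); by rewrite evP evQ => ->; rewrite mul0r.
have X1 : 'X - 1%:P != 0 :> {poly rat} by rewrite polyXsubC_eq0.
rewrite !mulf_eq0 polyX_eq0 (negPf X1) !orbF => /orP[/eqP P0|/eqP Q0].
  by left=> b _; rewrite evP P0 horner0.
by right=> b _; rewrite evQ Q0 horner0.
Qed.

Lemma family_rational : family_of_rational_curves parameters curve_family.
Proof.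
split; first exact: parameters_variety.
  by exists (fun=> 1%N) => i j; exact: curve_homog.
by move=> b [b0 b1]; rewrite member_family; exact: curve_rational.
Qed.

(** * Density of the family *)

Lemma coprime_multiple (a b : rat) : ~ (a = 0 /\ b = 0) ->
  exists c m n, [/\ c != 0, coprimez m n, a = c * m%:~R & b = c * n%:~R].
Proof.
move=> ab0; pose M := numq a * denq b; pose N := numq b * denq a.
have da : (denq a)%:~R != 0 :> rat by rewrite intr_eq0 denq_neq0.
have db : (denq b)%:~R != 0 :> rat by rewrite intr_eq0 denq_neq0.
have g0 : gcdz M N != 0.
  rewrite gcdz_eq0 !mulf_eq0 !numq_eq0 (negPf (denq_neq0 a)) (negPf (denq_neq0 b)).
  by rewrite !orbF; apply/andP => -[/eqP a0 /eqP b0]; apply: ab0.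
have [m [n [EM EN mn]]] := gcdz_decomp g0.
exists ((gcdz M N)%:~R / ((denq a)%:~R * (denq b)%:~R)), m, n; split=> //.
- by rewrite mulf_neq0 ?invr_eq0 ?mulf_neq0 // intr_eq0.
- have : (m%:~R * (gcdz M N)%:~R : rat) = (numq a)%:~R * (denq b)%:~R.
    by rewrite -!intrM -EM.
  rewrite -{2}[a]divq_num_den => E.
  rewrite mulrAC [_ * m%:~R]mulrC E; field; exact/andP.
- have : (n%:~R * (gcdz M N)%:~R : rat) = (numq b)%:~R * (denq a)%:~R.
    by rewrite -!intrM -EN.
  rewrite -{2}[b]divq_num_den => E.
  rewrite mulrAC [_ * n%:~R]mulrC E; field; exact/andP.
Qed.

Lemma coprime_coordinates (v : 'M[rat]_(3, 2)) :
    on_X v -> (forall i, ~ (v i 0 = 0 /\ v i 1 = 0)) ->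
  exists (y : XQ) (c : 'rV[rat]_3),
    (forall i, c 0 i != 0) /\ v = diag_mx c *m base_change rat y.
Proof.
move=> vX v0.
have /choice[f fP] : forall i, exists cmn : rat * int * int,
    [/\ cmn.1.1 != 0, coprimez cmn.1.2 cmn.2,
        v i 0 = cmn.1.1 * cmn.1.2%:~R & v i 1 = cmn.1.1 * cmn.2%:~R].
  by move=> i; have [c [m [n H]]] := coprime_multiple (v0 i); exists (c, m, n).
pose w : 'M[int]_(3, 2) := \matrix_(i, j) if j == 0 then (f i).1.2 else (f i).2.
have w_coprime i : coprimez (w i 0) (w i 1).
  by rewrite !mxE /=; case: (fP i).
have vE i j : v i j = (f i).1.1 * (w i j)%:~R.
  move: i j => i; elim/forall_ord2; rewrite mxE /=; by case: (fP i).
have w_on_X : on_X w.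
  have k0 : \prod_i (f i).1.1 != 0 :> rat.
    by apply/prodf_neq0 => i _; case: (fP i).
  apply: (@intr_inj rat); apply: (mulfI k0).
  move: vX; rewrite /on_X /s0 /s1 /t0 /t1 /u0 /u1 !vE !big_ord_recl big_ord0.
  rewrite [lift _ _](_ : _ = 1 :> 'I_3); last exact/val_inj.
  rewrite [lift _ _](_ : _ = 2%:R :> 'I_3); last exact/val_inj.
  rewrite !intrM => E; move: (f 0).1.1 (f 1).1.1 (f 2%:R).1.1 E => a b c E.
  by apply: etrans (etrans E _); ring.
exists (PointXQ w_coprime w_on_X), (\row_i (f i).1.1); split.
  by move=> i; rewrite mxE; case: (fP i).
by apply/matrixP => i j; rewrite mul_diag_mx !mxE vE mxE.
Qed.

(** The image in P^1 x P^1 of the curve of parameter [b] has the equation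
[b * (s0 * (t0 - t1)) = t1 * (s1 - s0)].  Off the zero locus of this form it has
a solution [b] other than [0] and [1], and [s0 t0 u1 = s1 t1 u0] determines [u]. *)
Definition generic_form (A : comNzRingType) (v : 'M[A]_(3, 2)) : A :=
  s0 v * s1 v * t0 v * t1 v * (s0 v - s1 v) * (t0 v - t1 v) * (u0 v - u1 v).

Lemma generic_swept_out y : generic_form (base_change rat y) != 0 ->
  swept_out parameters curve_family y.
Proof.
rewrite /generic_form !mulf_eq0 !negb_or.
move=> /andP[/andP[/andP[/andP[/andP[/andP[s0n s1n] t0n] t1n] sn] tn] un].
have yX : on_X (base_change rat y).
  have := congr1 (fun z : int => z%:~R : rat) (coords_on_X y).
  by rewrite /= !intrM /on_X /s0 /s1 /t0 /t1 /u0 /u1 !mxE.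
move: s0n s1n t0n t1n sn tn un yX; rewrite /on_X.
set v := base_change rat y.
move es0 : (s0 v) => a; move es1 : (s1 v) => a'.
move et0 : (t0 v) => d; move et1 : (t1 v) => d'.
move eu0 : (u0 v) => e; move eu1 : (u1 v) => e' a0 a'0 d0 d'0 an dn en yX.
pose b := d' * (a' - a) / (a * (d - d')).
have bE : b * (a * (d - d')) = d' * (a' - a).
  by rewrite /b mulfVK // mulf_neq0.
have b0 : b != 0.
  rewrite /b mulf_neq0 ?invr_eq0 ?mulf_neq0 //.
  by rewrite subr_eq0 eq_sym -subr_eq0.
have ad : a * d != a' * d'.
  apply: contraNneq en => E; rewrite subr_eq0; apply/eqP.
  by apply: (mulfI (mulf_neq0 a0 d0)); rewrite {1}E yX.
have b1 : b != 1.
  apply: contraNneq ad => b1; move: bE; rewrite b1 mul1r => E.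
  rewrite -subr_eq0; apply/eqP.
  have -> : a * d - a' * d' = a * (d - d') - d' * (a' - a) by ring.
  by rewrite E subrr.
pose z : 'rV[algC]_2 := \row_j ratr (if j == 0 then a else a' - a).
have ratrv i j : base_change algC y i j = ratr (v i j).
  by rewrite !mxE ratr_int.
exists (fun=> b); first by split.
rewrite member_family; exists z.
  by apply/rV2_neq0; rewrite !mxE /= => -[/eqP]; rewrite fmorph_eq0 (negPf a0).
rewrite evalP1_curve !mxE /=.
elim/forall_ord3; rewrite !mx32E !ratrv -!(rmorphD, rmorphM) /=; congr ratr.
- rewrite -[v 0 1]/(s1 v) -[v 0 0]/(s0 v) es0 es1; ring.
- rewrite -[v 1 1]/(t1 v) -[v 1 0]/(t0 v) et0 et1.
  by apply/eqP; rewrite -subr_eq0; apply/eqP; move/eqP: bE; rewrite -subr_eq0 => /eqP bE;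
     rewrite -oppr0 -[in RHS]bE; ring.
- rewrite -[v 2%:R 1]/(u1 v) -[v 2%:R 0]/(u0 v) eu0 eu1.
  (* The equation of [X] gives [u1] in terms of [u0] only after multiplication by
     [d * d'], which is nonzero at a generic point. *)
  apply: (mulfI (mulf_neq0 d0 d'0)).
  have E1 : (b * a + (a' - a)) * d' = b * a * d.
    by move/eqP: bE; rewrite -subr_eq0 => /eqP bE; apply/eqP; rewrite -subr_eq0;
       apply/eqP; rewrite -oppr0 -[in RHS]bE; ring.
  transitivity (d * ((b * a + (a' - a)) * d') * e'); first ring.
  rewrite E1; transitivity (b * d * (a * d * e')); first ring.
  rewrite yX; ring.
Qed.

(** Multihomogeneity passes from coprime integral coordinates to arbitrary rational
ones, as needed to evaluate along polynomial paths. *)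
Lemma multihomog_swept_out_eq0 d p : multihomog d p ->
    (forall y, swept_out parameters curve_family y -> evalX p (base_change rat y) = 0) ->
  forall v, on_X v -> evalX p v * generic_form v = 0.
Proof.
move=> hp p0 v vX; have [->|gv] := eqVneq (generic_form v) 0; first by rewrite mulr0.
have v0 i : ~ (v i 0 = 0 /\ v i 1 = 0).
  move: i; elim/forall_ord3 => -[E0 E1]; move/eqP: gv; apply;
  rewrite /generic_form /s0 /s1 /t0 /t1 /u0 /u1 E0 E1; ring.
have [y [c [c0 Ev]]] := coprime_coordinates vX v0.
rewrite Ev hp p0 ?mulr0 ?mul0r //; apply: generic_swept_out.
move: gv; rewrite {1}Ev /generic_form /s0 /s1 /t0 /t1 /u0 /u1 !mul_diag_mx !mxE.
apply: contraNneq => E; apply/eqP.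
(* The generic form has multidegree [(3, 3, 1)]. *)
transitivity (c 0 0 ^+ 3 * c 0 1 ^+ 3 * c 0 2%:R * 0); last by rewrite mulr0.
rewrite -E; ring.
Qed.

Lemma evalX_path (P : 'M[{poly rat}]_(3, 2)) p :
  exists Q : {poly rat}, forall x, evalX p (map_mx (horner^~ x) P) = Q.[x].
Proof.
have [Q hQ] := meval_poly p (mxvec P 0); exists Q => x.
by rewrite -hQ /evalX; apply: meval_eq => i; rewrite -map_mxvec mxE.
Qed.

(** Along the path the restrictions of [p] and of [generic_form] are polynomials in
one variable with product [0]; the second one is nonzero at [1], so the first one
is [0]. *)
Lemma evalX_eq0_by_path d p (P : 'M[{poly rat}]_(3, 2)) (c : 'rV[rat]_3) v :
    multihomog d p ->
    (forall v, on_X v -> evalX p v * generic_form v = 0) ->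
    on_X P -> map_mx (horner^~ 0) P = diag_mx c *m v -> (forall i, c 0 i != 0) ->
    generic_form (map_mx (horner^~ 1) P) != 0 ->
  evalX p v = 0.
Proof.
move=> hp pg PX P0 c0 P1; have [Q hQ] := evalX_path P p.
have gE x : generic_form (map_mx (horner^~ x) P) = (generic_form P).[x].
  by rewrite /generic_form /s0 /s1 /t0 /t1 /u0 /u1 !mxE !hornerE.
have /eqP : Q * generic_form P = 0.
  apply: numDomain_poly_eq0 => x; rewrite hornerM -hQ -gE; apply: pg.
  have := congr1 (horner^~ x) PX.
  by rewrite /on_X /s0 /s1 /t0 /t1 /u0 /u1 !mxE !hornerE.
rewrite mulf_eq0 => /orP[/eqP Q0|/eqP g0]; last first.
  by move: P1; rewrite gE g0 horner0 eqxx.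
have := hQ 0; rewrite Q0 horner0 P0 hp => /eqP.
rewrite mulf_eq0 => /orP[|/eqP //].
by move=> /prodf_eq0[i _]; rewrite expf_eq0 (negPf (c0 i)) andbF.
Qed.

Lemma proportional_rows (a b k l : rat) :
    ~ (a = 0 /\ b = 0) -> ~ (k = 0 /\ l = 0) -> a * l = b * k ->
  exists2 c, c != 0 & k = c * a /\ l = c * b.
Proof.
move=> ab kl E; have [a0|a0] := eqVneq a 0.
  have b0 : b != 0 by apply/eqP => b0; apply: ab.
  have k0 : k = 0 by apply: (mulfI b0); rewrite -E a0 mul0r mulr0.
  exists (l / b); last by rewrite mulfVK // a0 k0 mulr0.
  by rewrite mulf_neq0 ?invr_eq0 //; apply/eqP => l0; apply: kl.
have lE : l = k / a * b by rewrite mulrAC [k * b]mulrC -E mulrAC mulfV ?mul1r.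
exists (k / a); last by rewrite mulfVK.
rewrite mulf_neq0 ?invr_eq0 //; apply/eqP => k0.
by apply: kl; split => //; rewrite lE k0 mul0r mul0r.
Qed.

Definition line (a b : rat) : {poly rat} := a%:P + (b - a) *: 'X.

Lemma line0 a b : (line a b).[0] = a.
Proof. by rewrite /line hornerD hornerC hornerZ hornerX mulr0 addr0. Qed.

Lemma line1 a b : (line a b).[1] = b.
Proof. by rewrite /line hornerD hornerC hornerZ hornerX mulr1 addrC subrK. Qed.

(** Two rows of a point of [X] determine the third one unless both products in
the equation vanish, and at every point some choice of two rows does.  Moving
these two rows linearly to a generic position and letting the third one follow
gives the path; the generic position is always [(1, 2)], [(1, 3)], [(1, 6)], up to
scaling of the third row. *)
Lemma evalX_eq0_on_X d p v : multihomog d p ->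
    (forall v, on_X v -> evalX p v * generic_form v = 0) ->
    on_X v -> (forall i, ~ (v i 0 = 0 /\ v i 1 = 0)) ->
  evalX p v = 0.
Proof.
move=> hp pg vX v0.
have vE : v = mx32 (s0 v) (s1 v) (t0 v) (t1 v) (u0 v) (u1 v).
  by apply/matrixP; elim/forall_ord3; elim/forall_ord2; rewrite !mx32E.
have case_u : ~ (s0 v * t0 v = 0 /\ s1 v * t1 v = 0) -> evalX p v = 0.
  move=> n0; have [|c c0 [E0 E1]] := proportional_rows (v0 2%:R) n0.
    by rewrite mulrC -[RHS]mulrC; apply/esym; exact: vX.
  pose a := line (s0 v) 1; pose a' := line (s1 v) 2.
  pose b := line (t0 v) 1; pose b' := line (t1 v) 3.
  apply: (@evalX_eq0_by_path d p (mx32 a a' b b' (a * b) (a' * b'))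
            (\row_i [:: 1; 1; c]`_i) v) => //.
  - rewrite /on_X /s0 /s1 /t0 /t1 /u0 /u1 !mx32E; ring.
  - rewrite map_mx32 !hornerM !line0 E0 E1 [in RHS]vE.
    by apply/matrixP; elim/forall_ord3; elim/forall_ord2;
      rewrite mul_diag_mx !mxE /= ?mul1r.
  - by elim/forall_ord3; rewrite !mxE.
  - by rewrite map_mx32 !hornerM !line1 /generic_form /s0 /s1 /t0 /t1 /u0 /u1 !mx32E.
have case_s : ~ (t1 v * u0 v = 0 /\ t0 v * u1 v = 0) -> evalX p v = 0.
  move=> n0; have [|c c0 [E0 E1]] := proportional_rows (v0 0) n0.
    by rewrite !mulrA; exact: vX.
  pose b := line (t0 v) 1; pose b' := line (t1 v) 3.
  pose e := line (u0 v) 1; pose e' := line (u1 v) 6.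
  apply: (@evalX_eq0_by_path d p (mx32 (b' * e) (b * e') b b' e e')
            (\row_i [:: c; 1; 1]`_i) v) => //.
  - rewrite /on_X /s0 /s1 /t0 /t1 /u0 /u1 !mx32E; ring.
  - rewrite map_mx32 !hornerM !line0 E0 E1 [in RHS]vE.
    by apply/matrixP; elim/forall_ord3; elim/forall_ord2;
      rewrite mul_diag_mx !mxE /= ?mul1r.
  - by elim/forall_ord3; rewrite !mxE.
  - by rewrite map_mx32 !hornerM !line1 /generic_form /s0 /s1 /t0 /t1 /u0 /u1 !mx32E.
have case_t : ~ (s1 v * u0 v = 0 /\ s0 v * u1 v = 0) -> evalX p v = 0.
  move=> n0; have [|c c0 [E0 E1]] := proportional_rows (v0 1) n0.
    by rewrite !mulrA [v 1 0 * _]mulrC [v 1 1 * _]mulrC; exact: vX.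
  pose a := line (s0 v) 1; pose a' := line (s1 v) 2.
  pose e := line (u0 v) 1; pose e' := line (u1 v) 6.
  apply: (@evalX_eq0_by_path d p (mx32 a a' (a' * e) (a * e') e e')
            (\row_i [:: 1; c; 1]`_i) v) => //.
  - rewrite /on_X /s0 /s1 /t0 /t1 /u0 /u1 !mx32E; ring.
  - rewrite map_mx32 !hornerM !line0 E0 E1 [in RHS]vE.
    by apply/matrixP; elim/forall_ord3; elim/forall_ord2;
      rewrite mul_diag_mx !mxE /= ?mul1r.
  - by elim/forall_ord3; rewrite !mxE.
  - by rewrite map_mx32 !hornerM !line1 /generic_form /s0 /s1 /t0 /t1 /u0 /u1 !mx32E.
have [[st st']|/case_u //] := pselect (s0 v * t0 v = 0 /\ s1 v * t1 v = 0).
have [[tu tu']|/case_s //] := pselect (t1 v * u0 v = 0 /\ t0 v * u1 v = 0).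
have [[su su']|/case_t //] := pselect (s1 v * u0 v = 0 /\ s0 v * u1 v = 0).
have nz i : ~~ ((v i 0 == 0) && (v i 1 == 0)).
  by apply/andP => -[/eqP E0 /eqP E1]; exact: v0 i (conj E0 E1).
exfalso; move: (nz 0) (nz 1) (nz 2%:R).
rewrite -/(s0 v) -/(s1 v) -/(t0 v) -/(t1 v) -/(u0 v) -/(u1 v).
move/eqP: st; move/eqP: st'; move/eqP: tu; move/eqP: tu'; move/eqP: su; move/eqP: su'.
rewrite !mulf_eq0.
by case: (s0 v == 0); case: (s1 v == 0); case: (t0 v == 0);
  case: (t1 v == 0); case: (u0 v == 0); case: (u1 v == 0).
Qed.

Lemma family_dense : zariski_denseX (swept_out parameters curve_family).
Proof.
move=> d p hp p0 y.
apply: evalX_eq0_on_X hp (multihomog_swept_out_eq0 hp p0) _ _.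
  have := congr1 (fun z : int => z%:~R : rat) (coords_on_X y).
  by rewrite /= !intrM /on_X /s0 /s1 /t0 /t1 /u0 /u1 !mxE.
move=> i; rewrite !mxE => -[/eqP + /eqP]; rewrite !intr_eq0 => /eqP y0 /eqP y1.
by have := coords_coprime y i; rewrite y0 y1.
Qed.

(** * Integral points on the curves *)

Section IntegralPoints.
Variables (p q j : int).
Let N := q - p.
Let K := q * j.

(** The parameters [m = N K - 1] and [w = 1] on the curve with [b = p / q]: as
[N = q - p], one has [p m + q = N (p K + 1)] and [p (m + 1) = p N K], so that
[N] cancels in the third row and leaves a difference of [1].  That [K] is a multiple
of [q] makes the second row coprime: its entries differ by [q]. *)
Definition curve_point_mx : 'M[int]_(3, 2) :=
  mx32 (N * K - 1) (N * K)
       (N * (p * K + 1)) (p * (N * K - 1))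
       (p * K + 1) (p * K).

Hypothesis pq : coprimez p q.

Lemma curve_point_coprime i : coprimez (curve_point_mx i 0) (curve_point_mx i 1).
Proof.
move: i; elim/forall_ord3; rewrite !mx32E.
- by apply/coprimezP; exists (-1, 1) => /=; ring.
- rewrite coprimezMl !coprimezMr; apply/andP; split; apply/andP; split.
  + have /coprimezP[[u v] /= E] := pq; apply/coprimezP; exists (v, u + v) => /=.
    by rewrite -E /N; ring.
  + by apply/coprimezP; exists (K, -1) => /=; ring.
  + by apply/coprimezP; exists (1, - K) => /=; ring.
  + (* [N * (p * K + 1) - p * (N * K - 1) = q] divides [K]. *)
    apply/coprimezP; exists (j * N ^+ 2, - (j * N * p + 1)) => /=.
    by rewrite /K /N; ring.
- by apply/coprimezP; exists (1, -1) => /=; ring.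
Qed.

Lemma curve_point_on_X : on_X curve_point_mx.
Proof. by rewrite /on_X /s0 /s1 /t0 /t1 /u0 /u1 !mx32E; ring. Qed.

Definition curve_point : XQ := PointXQ curve_point_coprime curve_point_on_X.

Lemma curve_point_integral : integral_points curve_point.
Proof. by rewrite /integral_points /= /u0 /u1 !mx32E addrAC subrr add0r unitr1. Qed.

Lemma curve_point_off_L1 : ~ L1 curve_point.
Proof. by rewrite /L1 /= /s0 /s1 !mx32E; lia. Qed.

Lemma curve_point_off_L2 : q != 0 -> ~ L2 curve_point.
Proof.
move=> /eqP q0; rewrite /L2 /= /t0 /t1 !mx32E => E; apply: q0.
have -> : q = N * (p * K + 1) - p * (N * K - 1) by rewrite /N; ring.
by rewrite E subrr.
Qed.

Lemma curve_point_neq_pt11 : ~ same_point pt11 curve_point.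
Proof. by move=> /(_ 0); rewrite /= !mx32E !mxE; lia. Qed.

Lemma curve_point_on_curve : q != 0 ->
  curve_points (curve (p%:~R / q%:~R)) curve_point.
Proof.
move=> q0; have q0C : q%:~R != 0 :> algC by rewrite intr_eq0.
exists (\row_k if k == 0 then (N * K - 1)%:~R else 1).
  by apply/rV2_neq0; rewrite !mxE /= => -[_ /eqP]; rewrite oner_eq0.
rewrite evalP1_curve; have -> : ratr (p%:~R / q%:~R) = p%:~R / q%:~R :> algC.
  by rewrite fmorph_div /= !ratr_int.
rewrite !mxE /= /base_change map_mx32.
by elim/forall_ord3; rewrite !mx32E /N !(intrM, intrD, intrN); field.
Qed.

End IntegralPoints.

Section Bounds.
Variable R : realType.

Lemma row_sin2_le (y : XQ) i (m : nat) : m.+1%:Z ^+ 2 <= y i 0 ^+ 2 + y i 1 ^+ 2 ->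
  row_sin2 R y i <= ((y i 0 - y i 1) ^+ 2)%:~R / m.+1%:R ^+ 2.
Proof.
rewrite -(ler_int R) !(rmorphD, rmorphXn, rmorphN) /= => H.
have m0 : 0 < (m.+1%:R : R) ^+ 2 by rewrite exprn_gt0 ?ltr0n.
rewrite /row_sin2 /sin2 ler_wpM2l ?sqr_ge0 // lef_pV2 ?posrE //.
  by apply: le_trans H _; rewrite ler_peMl ?ler1n // addr_ge0 ?sqr_ge0.
by rewrite mulr_gt0 //; apply: lt_le_trans H.
Qed.

Lemma height_le (y : XQ) (a b : nat) :
    `|s0 y| <= a%:Z -> `|s1 y| <= a%:Z -> `|t0 y| <= b%:Z -> `|t1 y| <= b%:Z ->
  (height y <= a * b)%N.
Proof.
move=> h0 h1 k0 k1; rewrite /height !geq_max !abszM.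
by rewrite !leq_mul //; lia.
Qed.

Lemma sqr_le_mull (N a : int) : N != 0 -> a ^+ 2 <= (N * a) ^+ 2.
Proof.
move=> N0; rewrite exprMn ler_peMl ?sqr_ge0 //.
by have : 0 < N ^+ 2; [rewrite exprn_even_gt0 | lia].
Qed.

Lemma sqr_le_norm (a b : int) : 0 <= a -> a <= `|b| -> a ^+ 2 <= b ^+ 2.
Proof.
by move=> a0 ab; rewrite -(real_normK (num_real b)) ler_sqr ?nnegrE.
Qed.

Variables (p q : int).
Hypothesis pq : coprimez p q.

(* As [K >= n + 2], both [N * K] and [p * K + 1] are at least [n + 1] in absolute
   value, whatever the sign of [p]. *)
Let y (n : nat) := curve_point n.+2%:Z pq.

Lemma curve_point_height : exists M : nat, forall n,
  (height (y n) <= M * n.+1 ^ 2)%N.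
Proof.
pose a : nat := (absz ((q - p) * q)%R * 2 + 1)%N.
pose b : nat := (absz ((q - p) * p * q)%R * 2 + absz (q - p)%R + absz p)%N.
exists (a * b)%N => n.
have -> : (a * b * n.+1 ^ 2 = (a * n.+1) * (b * n.+1))%N by rewrite expnS expn1; lia.
apply: height_le; rewrite /= /s0 /s1 /t0 /t1 !mx32E.
- rewrite (_ : _ - 1 = ((q - p) * q) * n.+2%:Z - 1); last by ring.
  by rewrite /a; move: ((q - p) * q) => c; nia.
- rewrite mulrA /a; move: ((q - p) * q) => c; nia.
- rewrite (_ : _ * _ = ((q - p) * p * q) * n.+2%:Z + (q - p)); last by ring.
  by rewrite /b; move: ((q - p) * p * q) (q - p) => c d; nia.
- rewrite (_ : _ * _ = ((q - p) * p * q) * n.+2%:Z - p); last by ring.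
  by rewrite /b; move: ((q - p) * p * q) (q - p) => c d; nia.
Qed.

Hypotheses (q_gt0 : 0 < q) (p_neq0 : p != 0) (pq_neq : p != q).

(** The squared sines are at most [1 / n^2], [q^2 / n^2] and [1 / n^2]: the
numerators [s0 - s1], [t0 - t1] and [u0 - u1] are [-1], [q] and [1]. *)
Lemma curve_point_dist n : distQ R pt11 (y n) <= (q%:~R + 2) / n.+1%:R.
Proof.
have n0 : 0 < (n.+1%:R : R) by rewrite ltr0n.
have q0 : 0 < (q%:~R : R) by rewrite ltr0z.
have C0 : 0 <= (q%:~R + 2) / n.+1%:R :> R.
  by rewrite divr_ge0 ?ler0n // addr_ge0 ?ler0n // ltW.
rewrite -ler_sqr ?nnegrE ?distQ_pt11_ge0 //.
apply: le_trans (distQ_le_sum_sin2 _ _) _.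
have K_ge : n.+2%:Z <= q * n.+2%:Z by nia.
have N_neq0 : q - p != 0 by rewrite subr_eq0 eq_sym.
have hs : row_sin2 R (y n) 0 <= 1 / n.+1%:R ^+ 2.
  have := @row_sin2_le (y n) 0 n; rewrite /= !mx32E.
  move: (q * _) K_ge (q - p) N_neq0 => K KE N N0.
  have -> : (N * K - 1 - N * K) ^+ 2 = 1 by ring.
  apply; have : n.+1%:Z ^+ 2 <= K ^+ 2 by apply: sqr_le_norm; lia.
  have : K ^+ 2 <= (N * K) ^+ 2 by exact: sqr_le_mull.
  by have := sqr_ge0 (N * K - 1); lia.
have ht : row_sin2 R (y n) 1 <= q%:~R ^+ 2 / n.+1%:R ^+ 2.
  have := @row_sin2_le (y n) 1 n; rewrite /= !mx32E.
  have -> : ((q - p) * (p * (q * n.+2%:Z) + 1) - p * ((q - p) * (q * n.+2%:Z) - 1)) = q.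
    by ring.
  rewrite rmorphXn /=; apply.
  move: (q * _) K_ge (q - p) N_neq0 => K KE N N0.
  have hK : n.+1%:Z ^+ 2 <= (p * K + 1) ^+ 2 by apply: sqr_le_norm; nia.
  have : (p * K + 1) ^+ 2 <= (N * (p * K + 1)) ^+ 2.
    exact: sqr_le_mull.
  by have := sqr_ge0 (p * (N * K - 1)); lia.
have hu : row_sin2 R (y n) 2%:R <= 1 / n.+1%:R ^+ 2.
  have := @row_sin2_le (y n) 2%:R n; rewrite /= !mx32E.
  move: (q * _) K_ge => K KE.
  have -> : (p * K + 1 - p * K) ^+ 2 = 1 by ring.
  apply; have hK : n.+1%:Z ^+ 2 <= (p * K + 1) ^+ 2 by apply: sqr_le_norm; nia.
  by have := sqr_ge0 (p * K); lia.
rewrite !big_ord_recl big_ord0.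
rewrite [lift _ _](_ : _ = 1 :> 'I_3); last exact/val_inj.
rewrite [lift _ _](_ : _ = 2%:R :> 'I_3); last exact/val_inj.
rewrite addr0; apply: le_trans (lerD hs (lerD ht hu)) _.
rewrite -!mulrDl expr_div_n ler_wpM2r ?invr_ge0 ?sqr_ge0 //.
by rewrite sqrrD; nra.
Qed.

End Bounds.

Lemma coprimez_num_den (b : rat) : coprimez (numq b) (denq b).
Proof. exact: coprime_num_den. Qed.

(** * Approximation constants *)

Section Main.
Variable R : realType.

(** This covers at once the points of [X] off the two lines and those of a single
curve: lying off [L1] and [L2] gives the lower bound, and the sequence
[curve_point] on the curve of parameter [b] the upper bound. *)
Lemma approx_const_through_curve (b : rat) W : b != 0 -> b != 1 ->
    (forall y : XQ, W y -> ~ same_point pt11 y -> ~ L1 y /\ ~ L2 y) ->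
    (forall y : XQ, integral_points y -> ~ L1 y -> ~ L2 y ->
       curve_points (curve b) y -> W y) ->
  approx_const R pt11 W = 2%:E.
Proof.
move=> b0 b1 W_off bW.
have pq := coprimez_num_den b; have q_gt0 := denq_gt0 b.
have p0 : numq b != 0 by rewrite numq_eq0.
have pq_neq : numq b != denq b.
  apply: contraNneq b1 => E; rewrite -[b]divq_num_den E divff //.
  by rewrite intr_eq0 denq_neq0.
have [M hM] := curve_point_height pq.
pose C : R := (denq b)%:~R + 2 + M%:R.
have q0 : 0 < ((denq b)%:~R : R) by rewrite ltr0z.
apply: (@approx_const_eq2 R W (fun n => curve_point n.+2%:Z pq) C) => // n.
- split; last exact: curve_point_neq_pt11.
  apply: bW; first exact: curve_point_integral.
  + exact: curve_point_off_L1.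
  + exact: curve_point_off_L2.
  + by rewrite -[b in curve b]divq_num_den; exact: curve_point_on_curve.
- apply: le_trans (curve_point_dist R pq q_gt0 p0 pq_neq n) _.
  by rewrite ler_wpM2r ?invr_ge0 ?ler0n // /C lerDl.
- have -> : C * n.+1%:R ^+ 2 = ((denq b)%:~R + 2) * n.+1%:R ^+ 2 + (M * n.+1 ^ 2)%:R.
    by rewrite natrM natrX /C mulrDl.
  apply: le_trans (_ : (M * n.+1 ^ 2)%:R <= _); first by rewrite ler_nat hM.
  by rewrite lerDr mulr_ge0 ?sqr_ge0 // addr_ge0 // ltW.
Qed.

Lemma zariski_open_off_lines : zariski_openX (~` (L1 `|` L2)).
Proof.
pose f := (coordX 0 0 - coordX 0 1) * (coordX 1 0 - coordX 1 1).
exists [set f]; split.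
  move=> _ ->; eexists; apply: multihomogM; apply: multihomogB;
  exact: multihomog_coord.
have fE y : evalX f (base_change rat y) != 0 <-> s0 y != s1 y /\ t0 y != t1 y.
  rewrite evalXM !evalXB !evalX_coord !mxE -!intrB -intrM intr_eq0 mulf_eq0.
  by rewrite !subr_eq0 negb_or; split => /andP.
apply/seteqP; split=> y /=.
  move=> nL; exists f => //; apply/fE; split; apply/eqP => E; apply: nL;
    by [left | right].
by move=> [_ -> /fE[/eqP n1 /eqP n2]] [].
Qed.

Lemma approx_const_off_lines :
  approx_const R pt11 (integral_points `\` (L1 `|` L2)) = 2%:E.
Proof.
apply: (@approx_const_through_curve 2) => //.
  by move=> y [_ nL] _; split=> yL; apply: nL; [left | right].
by move=> y yI n1 n2 _; split=> // -[].
Qed.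

Lemma approx_const_curve (b : rat) : b != 0 -> b != 1 ->
  approx_const R pt11 (integral_points `&` curve_points (curve b)) = 2%:E.
Proof.
move=> b0 b1; apply: (approx_const_through_curve b0 b1).
  by move=> y [_ yb]; exact: curve_points_off_lines yb.
by move=> y yI _ _ yb; split.
Qed.

End Main.

Theorem theorem5p7 (R : realType) :
  approx_const R pt11 (integral_points `\` (L1 `|` L2)) = 2%:E /\
  exists V : set XQ,
    [/\ zariski_openX V, V !=set0 &
      exists (n : nat) (B : set ('I_n -> rat))
             (Phi : 'M[{mpoly {mpoly rat[n]}[2]}]_(3, 2)),
        [/\ family_of_rational_curves B Phi,
            forall b, B b ->
              log_rational (member Phi b) \/ toroidal (member Phi b),
            zariski_denseX (swept_out B Phi) &
            forall b, B b ->
              approx_const R pt11 (integral_points `&` curve_points (member Phi b)) =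
              approx_const R pt11 (integral_points `&` V)]].
Proof.
split; first exact: approx_const_off_lines.
exists (~` (L1 `|` L2)); split; first exact: zariski_open_off_lines.
  have pq : coprimez 2 1 by [].
  exists (curve_point 0 pq) => -[]; first exact: curve_point_off_L1.
  exact: curve_point_off_L2.
exists 1%N, parameters, curve_family; split.
- exact: family_rational.
- by move=> b [b0 b1]; left; rewrite member_family; exact: curve_log_rational.
- exact: family_dense.
- move=> b [b0 b1]; rewrite member_family approx_const_curve //.
  by rewrite -setDE approx_const_off_lines.
Qed.
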